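(* Let $m>1$ be an integer, let $u$ be a positive smooth function on a manifold $B$ of dimension at least $3$, and let $(B,g_B,\nabla u,-\frac{m}{u},\lambda)$ be a gradient $(-\frac{m}{u})$-Ricci soliton. If $B$ is compact, assume in addition that $\lambda>0$. Let $\mu$ be a constant satisfying $$\lambda u^2+u\Delta u+(m-1)|\nabla u|^2=\mu\quad\text{on } B,$$ and let $(\mathbb{F}^m,\langle\,,\rangle)$ be an $m$-dimensional Riemannian manifold with Ricci tensor $Ric_{\mathbb{F}}=\mu\langle\,,\rangle$. Then the warped product manifold $(B\times_u\mathbb{F}^m,g)$, with $g=g_B+u^2\langle\,,\rangle$, is Einstein with Ricci tensor $Ric=\lambda g$.
   Context: Manifolds are smooth and connected. For a smooth positive function $u$ on $B$ and a nonzero constant $m$, a gradient $(-\frac{m}{u})$-Ricci soliton $(B,g_B,\nabla u,-\frac{m}{u},\lambda)$ is a complete Riemannian manifold $(B,g_B)$ and a constant $\lambda\in\mathbb{R}$ such that $$Ric_B-\frac{m}{u}\nabla^2u=\lambda g_B,$$ where $Ric_B$ is the Ricci tensor of $g_B$ and $\nabla^2u$ is the Hessian of $u$ with respect to $g_B$. $\Delta u$ and $|\nabla u|$ are the Laplacian (trace of the Hessian) and gradient norm with respect to $g_B$. The warped product $B\times_u\mathbb{F}$ is the product manifold $B\times\mathbb{F}$ with metric $\pi_B^*g_B+(u\circ\pi_B)^2\pi_{\mathbb{F}}^*\langle\,,\rangle$, abbreviated $g_B+u^2\langle\,,\rangle$, where $\pi_B,\pi_{\mathbb{F}}$ are the projections.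 *)

(* Defs.v *)
From HB Require Import structures.
From mathcomp Require Import all_boot all_order all_algebra.
From mathcomp Require Import all_classical all_reals all_analysis.

Set Implicit Arguments.
Unset Strict Implicit.
Unset Printing Implicit Defensive.

Import Order.TTheory GRing.Theory Num.Theory numFieldNormedType.Exports.

Local Open Scope classical_set_scope.
Local Open Scope ring_scope.

Section calculus.
Variables (R : realType) (n : nat).

Definition pd (i : 'I_n) (f : 'rV[R]_n -> R) : 'rV[R]_n -> R :=
  fun x => 'D_(delta_mx 0 i) f x.

Definition iter_pd (s : seq 'I_n) (f : 'rV[R]_n -> R) : 'rV[R]_n -> R :=
  foldr pd f s.

(* C^oo on the open set [A]; the values of [f] off [A] are irrelevant. *)
Definition smooth_on (A : set 'rV[R]_n) (f : 'rV[R]_n -> R) : Prop :=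
  forall (s : seq 'I_n) x, A x -> differentiable (iter_pd s f) x.

End calculus.

Definition smooth_map_on (R : realType) (n k : nat) (A : set 'rV[R]_n)
    (f : 'rV[R]_n -> 'rV[R]_k) : Prop :=
  forall j : 'I_k, smooth_on A (fun x => f x 0 j).

(* A (0,2)-tensor field on an open subset of R^n is given by its Gram matrices
   [G x i j = G_x(e_i, e_j)].  The library Jacobian acts on row vectors on the
   right, ['d f x v = v *m 'J f x], so this is
   [(f^* G)_x(v, w) = G_(f x)(df v, df w)]. *)
Definition pull (R : realType) (k n : nat) (f : 'rV[R]_k -> 'rV[R]_n)
    (G : 'rV[R]_n -> 'M[R]_n) : 'rV[R]_k -> 'M[R]_k :=
  fun x => 'J f x *m G (f x) *m ('J f x)^T.

Section coordinates.
Variables (R : realType) (n : nat) (G : 'rV[R]_n -> 'M[R]_n).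

(* [christoffel k i j] is $\Gamma^k_{ij}$. *)
Definition christoffel (k i j : 'I_n) : 'rV[R]_n -> R := fun x =>
  2^-1 * \sum_(l < n) invmx (G x) k l *
    (pd i (fun y => G y j l) x + pd j (fun y => G y i l) x
     - pd l (fun y => G y i j) x).

(* [curvature l k i j] is $R^l{}_{kij}$, where
   $R(\partial_i,\partial_j)\partial_k = R^l{}_{kij}\partial_l$ and
   $R(X,Y) = \nabla_X\nabla_Y - \nabla_Y\nabla_X - \nabla_{[X,Y]}$. *)
Definition curvature (l k i j : 'I_n) : 'rV[R]_n -> R := fun x =>
  pd i (christoffel l j k) x - pd j (christoffel l i k) x
  + \sum_(p < n) (christoffel l i p x * christoffel p j k x
                  - christoffel l j p x * christoffel p i k x).

(* $Ric(Y,Z)$ is the trace of $X \mapsto R(X,Y)Z$; with this sign round spheres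
   have positive Ricci curvature. *)
Definition ricci : 'rV[R]_n -> 'M[R]_n := fun x =>
  \matrix_(j < n, k < n) \sum_(i < n) curvature i k i j x.

Variable f : 'rV[R]_n -> R.

Definition hessian : 'rV[R]_n -> 'M[R]_n := fun x =>
  \matrix_(i < n, j < n)
    (pd i (pd j f) x - \sum_(k < n) christoffel k i j x * pd k f x).

Definition laplacian : 'rV[R]_n -> R := fun x =>
  \tr (invmx (G x) *m hessian x).

Definition gradient : 'rV[R]_n -> 'rV[R]_n := fun x =>
  \row_(i < n) \sum_(j < n) invmx (G x) i j * pd j f x.

Definition tangent_norm (x v : 'rV[R]_n) : R :=
  Num.sqrt ((v *m G x *m v^T) 0 0).

End coordinates.

Record chart (R : realType) (T : topologicalType) (n : nat) := Chart {
  cdom : set T;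
  cmap : T -> 'rV[R]_n;
  cinv : 'rV[R]_n -> T;
  cdom_open : open cdom;
  cimg_open : open (cmap @` cdom);
  cmapK : forall p, cdom p -> cinv (cmap p) = p;
  cmap_cont : forall p, cdom p -> {for p, continuous cmap};
  cinv_cont : forall x, (cmap @` cdom) x -> {for x, continuous cinv}
}.

Definition cimg (R : realType) (T : topologicalType) (n : nat)
    (c : chart R T n) : set 'rV[R]_n := cmap c @` cdom c.

(* The smooth structure is given by one (not necessarily maximal) atlas. *)
Record manifold (R : realType) (n : nat) := Manifold {
  points :> topologicalType;
  points_nonempty : [set: points] !=set0;
  points_hausdorff : hausdorff_space points;
  points_second_countable : @second_countable points;
  points_connected : connected [set: points];
  atlas : Type;
  mchart : atlas -> chart R points n;
  atlas_cover : forall p, exists a, cdom (mchart a) p;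
  atlas_smooth : forall a b,
    smooth_map_on
      [set x | cimg (mchart a) x /\ cdom (mchart b) (cinv (mchart a) x)]
      (cmap (mchart b) \o cinv (mchart a))
}.

Definition local_fun (R : realType) (n : nat) (M : manifold R n)
    (u : M -> R) (a : atlas M) : 'rV[R]_n -> R := u \o cinv (mchart a).

Definition smooth_fun (R : realType) (n : nat) (M : manifold R n)
    (u : M -> R) : Prop :=
  forall a : atlas M, smooth_on (cimg (mchart a)) (local_fun u a).

Record riemannian (R : realType) (n : nat) := Riemannian {
  base :> manifold R n;
  metric : atlas base -> 'rV[R]_n -> 'M[R]_n;
  metric_smooth : forall a i j,
    smooth_on (cimg (mchart a)) (fun x => metric a x i j);
  metric_sym : forall a x, cimg (mchart a) x -> (metric a x)^T = metric a x;
  metric_pos : forall a x, cimg (mchart a) x ->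
    forall v : 'rV[R]_n, v != 0 -> 0 < (v *m metric a x *m v^T) 0 0;
  metric_change : forall a b x, cimg (mchart a) x ->
    cdom (mchart b) (cinv (mchart a) x) ->
    metric a x = pull (cmap (mchart b) \o cinv (mchart a)) (metric b) x
}.

Section riemannian_notions.
Variables (R : realType) (n : nat) (M : riemannian R n).

Definition curve_coord (gamma : R -> M) (a : atlas M) (k : 'I_n) : R -> R :=
  fun t => cmap (mchart a) (gamma t) 0 k.

Definition geodesic (gamma : R -> M) : Prop :=
  continuous gamma /\
  forall (a : atlas M) t, cdom (mchart a) (gamma t) -> forall k : 'I_n,
    let y := curve_coord gamma a in
    [/\ derivable (y k) t 1, derivable (derive1 (y k)) t 1 &
      derive1 (derive1 (y k)) t + \sum_(i < n) \sum_(j < n)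
        christoffel (metric a) k i j (cmap (mchart a) (gamma t))
          * derive1 (y i) t * derive1 (y j) t = 0].

(* Geodesic completeness: for every p and v in T_p M there is a geodesic defined
   on all of R with initial point p and initial velocity v. *)
Definition complete : Prop :=
  forall (a : atlas M) (p : M) (v : 'rV[R]_n), cdom (mchart a) p ->
  exists gamma : R -> M, [/\ geodesic gamma, gamma 0 = p &
    forall k, derive1 (curve_coord gamma a k) 0 = v 0 k].

Definition einstein (lambda : R) : Prop :=
  forall (a : atlas M) x, cimg (mchart a) x ->
    ricci (metric a) x = lambda *: metric a x.

(* The gradient (-m/u)-Ricci soliton (M, g, grad u, -m/u, lambda). *)
Definition gradient_soliton (m : R) (u : M -> R) (lambda : R) : Prop :=
  complete /\
  forall (a : atlas M) x, cimg (mchart a) x ->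
    ricci (metric a) x
      - (m / local_fun u a x) *: hessian (metric a) (local_fun u a) x
    = lambda *: metric a x.

End riemannian_notions.

Lemma near_eq_differentiable (R : realType) (V W : normedModType R)
    (f g : V -> W) (x : V) :
  (\forall y \near x, f y = g y) -> differentiable f x -> differentiable g x.
Proof.
move=> fg [[dfc fE]]; rewrite lim_id // in fE.
have gE : g = cst (g x) + 'd f x \o center x +o_x (center x).
  move: fE => /eqaddoP fE; apply/eqaddoP => e e0.
  have fgx : f x = g x := nbhs_singleton fg; rewrite -fgx; near=> y.
  have H : `|(f - (cst (f x) + 'd f x \o center x)) y| <= e * `|center x y|.
    by near: y; exact: fE.
  have fgy : f y = g y by near: y.
  by move: H; rewrite /= !fctE /= fgy.
apply/diffP => /=.
apply: (@getPex _ (fun (df : {linear V -> W}) => continuous df /\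
  forall y, g y = g (lim (nbhs x)) + df (y - lim (nbhs x))
                  +o_(y \near x) (y - lim (nbhs x)))).
exists ('d f x); split=> // y; rewrite lim_id //.
by rewrite {1}gE.
Unshelve. all: by end_near. Qed.

Section smooth_facts.
Variables (R : realType) (n : nat).
Implicit Types (f g : 'rV[R]_n -> R) (A : set 'rV[R]_n).

Lemma iter_pd_rcons s i f : iter_pd (rcons s i) f = iter_pd s (pd i f).
Proof. by rewrite /iter_pd -cats1 foldr_cat. Qed.

Lemma smooth_on_pd A f i : smooth_on A f -> smooth_on A (pd i f).
Proof. by move=> sf s x Ax; rewrite -iter_pd_rcons; exact: sf. Qed.

Lemma near_eq_iter_pd f g s (x : 'rV[R]_n) : (\forall y \near x, f y = g y) ->
  \forall y \near x, iter_pd s f y = iter_pd s g y.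
Proof.
move=> fg; elim: s => //= i s IH; have := @near_join _ x _ IH.
by apply: filterS => y; exact: near_eq_derive.
Qed.

Lemma eq_smooth_on A f g : open A -> (forall x, A x -> f x = g x) ->
  smooth_on A f -> smooth_on A g.
Proof.
move=> oA fg sf s x Ax.
apply: near_eq_differentiable (sf s x Ax); apply: near_eq_iter_pd.
by apply: filterS (open_nbhs_nbhs (conj oA Ax)).
Qed.

Lemma subset_smooth_on A B f : A `<=` B -> smooth_on B f -> smooth_on A f.
Proof. by move=> AB sf s x /AB; exact: sf. Qed.

Lemma smooth_on_diff A f x : smooth_on A f -> A x -> differentiable f x.
Proof. by move=> /(_ [::]); exact. Qed.

Lemma iter_pd_cst0 s : iter_pd s (cst 0) = cst 0 :> ('rV[R]_n -> R).
Proof. by elim: s => //= i s ->; apply/funext => x; exact: derive_cst. Qed.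

Lemma smooth_on0 A : smooth_on A (cst 0).
Proof. by move=> s x _; rewrite iter_pd_cst0. Qed.

(* [C^(k+1)] on [A]. *)
Let smooth_upto k A f :=
  forall s x, (size s <= k)%N -> A x -> differentiable (iter_pd s f) x.

Let smooth_uptoS k A f : (forall x, A x -> differentiable f x) ->
  (forall i, smooth_upto k A (pd i f)) -> smooth_upto k.+1 A f.
Proof.
move=> df sf; elim/last_ind => [|s i _] x sk Ax; first exact: df.
by rewrite iter_pd_rcons; apply: sf => //; rewrite size_rcons ltnS in sk.
Qed.

Let smooth_upto_pd k A f i : smooth_upto k.+1 A f -> smooth_upto k A (pd i f).
Proof.
by move=> sf s x sk Ax; rewrite -iter_pd_rcons; apply: sf; rewrite ?size_rcons.
Qed.

Let smooth_upto_le k A f : smooth_upto k.+1 A f -> smooth_upto k A f.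
Proof. by move=> sf s x sk; apply: sf; exact: leqW. Qed.

Let smooth_upto_diff k A f x : smooth_upto k A f -> A x -> differentiable f x.
Proof. by move=> /(_ [::] x); exact. Qed.

Let eq_smooth_upto k A f g : open A -> (forall x, A x -> f x = g x) ->
  smooth_upto k A f -> smooth_upto k A g.
Proof.
move=> oA fg sf s x sk Ax.
apply: near_eq_differentiable (sf s x sk Ax); apply: near_eq_iter_pd.
by apply: filterS (open_nbhs_nbhs (conj oA Ax)).
Qed.

Let smooth_uptoD k A f g : open A -> smooth_upto k A f -> smooth_upto k A g ->
  smooth_upto k A (fun x => f x + g x).
Proof.
move=> oA; elim: k f g => [|k IH] f g sf sg.
  case=> // x _ Ax.
  by apply: differentiableD; [exact: smooth_upto_diff sf Ax|
    exact: smooth_upto_diff sg Ax].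
apply: smooth_uptoS => [x Ax|i].
  by apply: differentiableD; [exact: smooth_upto_diff sf Ax|
    exact: smooth_upto_diff sg Ax].
apply: eq_smooth_upto (IH _ _ (smooth_upto_pd i sf) (smooth_upto_pd i sg));
  first by [].
move=> y Ay; rewrite /pd [in RHS]deriveD//; apply: diff_derivable.
  exact: smooth_upto_diff sf Ay.
exact: smooth_upto_diff sg Ay.
Qed.

Let smooth_uptoM k A f g : open A -> smooth_upto k A f -> smooth_upto k A g ->
  smooth_upto k A (fun x => f x * g x).
Proof.
move=> oA; elim: k f g => [|k IH] f g sf sg.
  case=> // x _ Ax.
  by apply: differentiableM; [exact: smooth_upto_diff sf Ax|
    exact: smooth_upto_diff sg Ax].
apply: smooth_uptoS => [x Ax|i].
  by apply: differentiableM; [exact: smooth_upto_diff sf Ax|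
    exact: smooth_upto_diff sg Ax].
apply: (@eq_smooth_upto _ _ (fun x => f x * pd i g x + g x * pd i f x)) => //.
  move=> y Ay; rewrite /pd [in RHS]deriveM//; apply: diff_derivable.
    exact: smooth_upto_diff sf Ay.
  exact: smooth_upto_diff sg Ay.
by apply: smooth_uptoD => //; apply: IH;
  by [exact: smooth_upto_le|exact: smooth_upto_pd].
Qed.

Lemma smooth_onM A f g : open A -> smooth_on A f -> smooth_on A g ->
  smooth_on A (fun x => f x * g x).
Proof.
move=> oA sf sg s x Ax; apply: (@smooth_uptoM (size s) A f g) => //.
  by move=> t y _; exact: sf.
by move=> t y _; exact: sg.
Qed.

End smooth_facts.

Lemma smooth_map_diff (R : realType) (n k : nat) (A : set 'rV[R]_n)
    (f : 'rV[R]_n -> 'rV[R]_k) x :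
  smooth_map_on A f -> A x -> differentiable f x.
Proof.
move=> sf Ax.
have -> : f = \sum_(j < k) (fun y => f y 0 j *: delta_mx 0 j).
  by apply/funext => y; rewrite {1}[f y]row_sum_delta fct_sumE.
apply: differentiable_sum => j; apply: differentiableZl.
exact: smooth_on_diff (sf j) Ax.
Qed.

Lemma pull_comp (R : realType) (k l n : nat) (f : 'rV[R]_k -> 'rV[R]_l)
    (g : 'rV[R]_l -> 'rV[R]_n) (G : 'rV[R]_n -> 'M[R]_n) x :
  differentiable f x -> differentiable g (f x) ->
  pull (g \o f) G x = pull f (pull g G) x.
Proof.
move=> df dg; rewrite /pull.
have -> : 'J (g \o f) x = 'J f x *m 'J g (f x).
  apply/row_matrixP => i; rewrite !rowE.
  by rewrite mulmxA !mul_rV_lin1 /= diff_comp.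
by rewrite trmx_mul !mulmxA.
Qed.

Section product_facts.
Variables (R : realType) (n m : nat).
Local Notation lsub := (@lsubmx R 1 n m).
Local Notation rsub := (@rsubmx R 1 n m).

Let lsub_l h i x :
  lsub (h *: delta_mx 0 (lshift m i) + x) = h *: delta_mx 0 i + lsub x.
Proof. by apply/rowP => j; rewrite !mxE eqxx (inj_eq (@lshift_inj _ _)). Qed.

Let lsub_r h i x : lsub (h *: delta_mx 0 (rshift n i) + x) = lsub x.
Proof.
by apply/rowP => j; rewrite !mxE eqxx /= eq_lrshift mulr0 add0r.
Qed.

Let rsub_r h i x :
  rsub (h *: delta_mx 0 (rshift n i) + x) = h *: delta_mx 0 i + rsub x.
Proof. by apply/rowP => j; rewrite !mxE eqxx (inj_eq (@rshift_inj _ _)). Qed.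

Let rsub_l h i x : rsub (h *: delta_mx 0 (lshift m i) + x) = rsub x.
Proof.
by apply/rowP => j; rewrite !mxE eqxx /= eq_rlshift mulr0 add0r.
Qed.

Lemma pd_lsub_l i (f : 'rV[R]_n -> R) :
  pd (lshift m i) (f \o lsub) = pd i f \o lsub.
Proof.
apply/funext => x; rewrite /pd /derive /=; do 2 f_equal.
by apply/funext => h; rewrite /= lsub_l.
Qed.

Lemma pd_lsub_r i (f : 'rV[R]_n -> R) : pd (rshift n i) (f \o lsub) = cst 0.
Proof.
apply/funext => x.
rewrite /pd -[RHS](derive_cst (f (lsub x)) x (delta_mx 0 (rshift n i))).
rewrite /derive /=; do 2 f_equal.
by apply/funext => h; rewrite /= lsub_r.
Qed.

Lemma pd_rsub_r i (f : 'rV[R]_m -> R) :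
  pd (rshift n i) (f \o rsub) = pd i f \o rsub.
Proof.
apply/funext => x; rewrite /pd /derive /=; do 2 f_equal.
by apply/funext => h; rewrite /= rsub_r.
Qed.

Lemma pd_rsub_l i (f : 'rV[R]_m -> R) : pd (lshift m i) (f \o rsub) = cst 0.
Proof.
apply/funext => x.
rewrite /pd -[RHS](derive_cst (f (rsub x)) x (delta_mx 0 (lshift m i))).
rewrite /derive /=; do 2 f_equal.
by apply/funext => h; rewrite /= rsub_l.
Qed.

Lemma smooth_on_lsub (A : set 'rV[R]_n) (f : 'rV[R]_n -> R) : smooth_on A f ->
  smooth_on (lsub @^-1` A) (f \o lsub).
Proof.
move=> sf s x Ax.
have [[t ->]|->] : (exists t, iter_pd s (f \o lsub) = iter_pd t f \o lsub) \/
    iter_pd s (f \o lsub) = cst 0.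
- elim: s => [|i s [[t IH]|IH]] /=; first by left; exists [::].
    rewrite IH; case: (split_ordP i) => j ->.
      by left; exists (j :: t); rewrite pd_lsub_l.
    by right; rewrite pd_lsub_r.
  by right; rewrite IH; have := @iter_pd_cst0 R (n + m) [:: i].
- by apply: differentiable_comp; [exact: differentiable_lsubmx|exact: sf].
- exact: differentiable_cst.
Qed.

Lemma smooth_on_rsub (A : set 'rV[R]_m) (f : 'rV[R]_m -> R) : smooth_on A f ->
  smooth_on (rsub @^-1` A) (f \o rsub).
Proof.
move=> sf s x Ax.
have [[t ->]|->] : (exists t, iter_pd s (f \o rsub) = iter_pd t f \o rsub) \/
    iter_pd s (f \o rsub) = cst 0.
- elim: s => [|i s [[t IH]|IH]] /=; first by left; exists [::].
    rewrite IH; case: (split_ordP i) => j ->.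
      by right; rewrite pd_rsub_l.
    by left; exists (j :: t); rewrite pd_rsub_r.
  by right; rewrite IH; have := @iter_pd_cst0 R (n + m) [:: i].
- by apply: differentiable_comp; [exact: differentiable_rsubmx|exact: sf].
- exact: differentiable_cst.
Qed.

Lemma jacobian_lsub x : 'J lsub x = col_mx 1%:M 0.
Proof.
apply/row_matrixP => i; rewrite [LHS]rowE mul_rV_lin1 /=.
rewrite (@diff_lin _ _ _ lsub); last exact: continuous_lsubmx.
apply/rowP => j; case: (split_ordP i) => k ->;
  by rewrite [LHS]mxE [RHS]mxE ?col_mxEu ?col_mxEd !mxE eqxx /=
    ?(inj_eq (@lshift_inj _ _)) ?(inj_eq (@rshift_inj _ _)) ?eq_lrshift
    ?eq_rlshift // eq_sym.
Qed.

Lemma jacobian_rsub x : 'J rsub x = col_mx 0 1%:M.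
Proof.
apply/row_matrixP => i; rewrite [LHS]rowE mul_rV_lin1 /=.
rewrite (@diff_lin _ _ _ rsub); last exact: continuous_rsubmx.
apply/rowP => j; case: (split_ordP i) => k ->;
  by rewrite [LHS]mxE [RHS]mxE ?col_mxEu ?col_mxEd !mxE eqxx /=
    ?(inj_eq (@lshift_inj _ _)) ?(inj_eq (@rshift_inj _ _)) ?eq_lrshift
    ?eq_rlshift // eq_sym.
Qed.

Lemma pull_lsub G x : pull lsub G x = block_mx (G (lsub x)) 0 0 0.
Proof.
rewrite /pull jacobian_lsub tr_col_mx trmx1 trmx0 mul_col_mx mul1mx mul0mx.
by rewrite mul_col_row ?mulmx1 ?mulmx0 ?mul0mx.
Qed.

Lemma pull_rsub G x : pull rsub G x = block_mx 0 0 0 (G (rsub x)).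
Proof.
rewrite /pull jacobian_rsub tr_col_mx trmx1 trmx0 mul_col_mx mul1mx mul0mx.
by rewrite mul_col_row ?mulmx1 ?mulmx0 ?mul0mx.
Qed.

Lemma cvg_row_mx (T : Type) (F : set_system T) (FF : Filter F)
    (f : T -> 'rV[R]_n) (g : T -> 'rV[R]_m) (a : 'rV[R]_n)
    (b : 'rV[R]_m) :
  f @ F --> a -> g @ F --> b ->
  (fun t => row_mx (f t) (g t)) @ F --> row_mx a b.
Proof.
move=> fa gb A [P nP PA].
have Ha : F (f @^-1` [set v | forall i j, P i (lshift m j) (v i j)]).
  apply: fa; exists (fun i j => P i (lshift m j)) => // i j.
  by have := nP i (lshift m j); rewrite row_mxEl.
have Hb : F (g @^-1` [set v | forall i j, P i (rshift n j) (v i j)]).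
  apply: gb; exists (fun i j => P i (rshift n j)) => // i j.
  by have := nP i (rshift n j); rewrite row_mxEr.
suff : F (fun t => A (row_mx (f t) (g t))) by [].
apply: filterS2 Ha Hb => t Ht Kt; apply: PA => i j.
have [k ->|k ->] := split_ordP j.
  by rewrite row_mxEl; exact: Ht.
by rewrite row_mxEr; exact: Kt.
Qed.

End product_facts.


Section product_topology_facts.
Variables T U : topologicalType.

Lemma hausdorff_prod : hausdorff_space T -> hausdorff_space U ->
  hausdorff_space (T * U)%type.
Proof.
move=> hT hU [a b] [c d] H; congr pair.
  apply: hT => A B nA nB.
  have [||[x y] [/= ? ?]] := H (fst @^-1` A) (fst @^-1` B); last by exists x.
    exact: (@cvg_fst _ _ (nbhs a) (nbhs b)).
  exact: (@cvg_fst _ _ (nbhs c) (nbhs d)).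
apply: hU => A B nA nB.
have [||[x y] [/= ? ?]] := H (snd @^-1` A) (snd @^-1` B); last by exists y.
  exact: (@cvg_snd _ _ (nbhs a) (nbhs b)).
exact: (@cvg_snd _ _ (nbhs c) (nbhs d)).
Qed.

Lemma open_setX (A : set T) (B : set U) : open A -> open B -> open (A `*` B).
Proof.
move=> oA oB; rewrite openE => -[a b] [/= Aa Bb]; exists (A, B) => //=.
by split; apply: open_nbhs_nbhs.
Qed.

Lemma second_countable_prod : @second_countable T -> @second_countable U ->
  @second_countable (T * U)%type.
Proof.
move=> [BT cT [oT bT]] [BU cU [oU bU]].
exists [set A `*` B | A in BT & B in BU].
  rewrite image2E; apply: sub_countable (countableX cT cU).
  exact: card_image_le.
split=> [_ [A /oT oA [B /oU oB <-]]|[a b] C]; first exact: open_setX.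
move=> [[P Q] /= [/bT[A [BA Aa] AP] /bU[B [BB Bb] BQ]] PQ].
exists (A `*` B); first by split=> //; exists A => //; exists B.
by move=> [x y] [/= /AP ? /BQ ?]; exact: PQ.
Qed.

Lemma connected_prod : connected [set: T] -> connected [set: U] ->
  connected [set: T * U].
Proof.
move=> cT cU C [[a b] Cab] [D oD CD] [E cE CE].
have -> : C = C `&` setT by rewrite setIT.
move: CD CE; rewrite !setTI => CD CE; subst D E.
have ctr (x : T) : continuous (fun y : U => (x, y)).
  by move=> y; apply: cvg_pair => //=; exact: cvg_cst.
have ctl (y : U) : continuous (fun x : T => (x, y)).
  by move=> x; apply: cvg_pair => //=; exact: cvg_cst.
have slice_r (x : T) (y z : U) : C (x, y) -> C (x, z).
  move=> Cxy; suff : [set w | C (x, w)] = setT.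
    by move=> /(congr1 (@^~ z)) /= ->.
  apply: cU; first by exists y.
    exists [set w | C (x, w)]; last by rewrite setTI.
    by apply: open_comp oD => w _; exact: ctr.
  exists [set w | C (x, w)]; last by rewrite setTI.
  by apply: preimage_closed cE => w _; exact: ctr.
have slice_l (x : T) (y : U) (z : T) : C (x, y) -> C (z, y).
  move=> Cxy; suff : [set w | C (w, y)] = setT.
    by move=> /(congr1 (@^~ z)) /= ->.
  apply: cT; first by exists x.
    exists [set w | C (w, y)]; last by rewrite setTI.
    by apply: open_comp oD => w _; exact: ctl.
  exists [set w | C (w, y)]; last by rewrite setTI.
  by apply: preimage_closed cE => w _; exact: ctl.
rewrite setIT; apply/seteqP; split=> // -[x y] _.
exact/slice_r/slice_l/Cab.
Qed.

End product_topology_facts.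

Section product_chart.
Variables (R : realType) (T U : topologicalType) (n m : nat).
Variables (c : chart R T n) (d : chart R U m).

Let dom : set (T * U) := cdom c `*` cdom d.
Let map (p : T * U) : 'rV[R]_(n + m) := row_mx (cmap c p.1) (cmap d p.2).
Let inv (z : 'rV[R]_(n + m)) : T * U := (cinv c (lsubmx z), cinv d (rsubmx z)).

Let imgE : map @` dom = lsubmx @^-1` cimg c `&` rsubmx @^-1` cimg d.
Proof.
apply/seteqP; split=> [_ [[p q] [/= dp dq] <-]|z [[p dp pz] [q dq qz]]].
  by split; rewrite /map /= ?row_mxKl ?row_mxKr; [exists p|exists q].
by exists (p, q) => //; rewrite /map /= pz qz hsubmxK.
Qed.

Let img_open : open (map @` dom).
Proof.
rewrite imgE; apply: openI; apply: open_comp; first last.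
- exact: cimg_open.
- by move=> z _; exact: continuous_rsubmx.
- exact: cimg_open.
- by move=> z _; exact: continuous_lsubmx.
Qed.

Let mapK p : dom p -> inv (map p) = p.
Proof.
case: p => p q [/= dp dq].
by rewrite /inv /map /= row_mxKl row_mxKr !cmapK.
Qed.

Let map_cont p : dom p -> {for p, continuous map}.
Proof.
case: p => p q [/= dp dq]; apply: cvg_row_mx.
  apply: (@cvg_comp _ _ _ fst (cmap c) _ (nbhs p)); last exact: cmap_cont.
  exact: (@cvg_fst _ _ (nbhs p) (nbhs q)).
apply: (@cvg_comp _ _ _ snd (cmap d) _ (nbhs q)); last exact: cmap_cont.
exact: (@cvg_snd _ _ (nbhs p) (nbhs q)).
Qed.

Let inv_cont z : (map @` dom) z -> {for z, continuous inv}.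
Proof.
rewrite imgE => -[lz rz].
have cl : {for z, continuous (cinv c \o lsubmx)}.
  by apply: continuous_comp; [exact: continuous_lsubmx|exact: cinv_cont].
have cr : {for z, continuous (cinv d \o rsubmx)}.
  by apply: continuous_comp; [exact: continuous_rsubmx|exact: cinv_cont].
exact: (cvg_pair cl cr).
Qed.

Definition prod_chart : chart R (T * U)%type (n + m) :=
  Chart (open_setX (cdom_open c) (cdom_open d)) img_open mapK map_cont inv_cont.

Lemma cimg_prod_chart :
  cimg prod_chart = lsubmx @^-1` cimg c `&` rsubmx @^-1` cimg d.
Proof. exact: imgE. Qed.

End product_chart.

Section product_manifold.
Variables (R : realType) (n m : nat) (M : manifold R n) (N : manifold R m).

Let pchart (a : atlas M * atlas N) := prod_chart (mchart a.1) (mchart a.2).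

Let nonempty : [set: M * N] !=set0.
Proof.
have [p _] := points_nonempty M; have [q _] := points_nonempty N.
  by exists (p, q).
Qed.

Let cover (p : M * N) : exists a, cdom (pchart a) p.
Proof.
have [a da] := atlas_cover p.1; have [b db] := atlas_cover p.2.
by exists (a, b).
Qed.

Let smooth a b : smooth_map_on
  [set x | cimg (pchart a) x /\ cdom (pchart b) (cinv (pchart a) x)]
  (cmap (pchart b) \o cinv (pchart a)).
Proof.
move=> j; have [k ->|k ->] := split_ordP j.
  have := smooth_on_lsub (m := m) (@atlas_smooth _ _ M a.1 b.1 k).
  move=> /subset_smooth_on sf.
  rewrite (_ : (fun x => _) =
    (fun x => (cmap (mchart b.1) \o cinv (mchart a.1)) x 0 k) \o lsubmx).
    apply: sf => x; rewrite cimg_prod_chart => -[[? ?] [? ?]]; by split.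
  by apply/funext => x /=; rewrite row_mxEl.
have := smooth_on_rsub (n := n) (@atlas_smooth _ _ N a.2 b.2 k).
move=> /subset_smooth_on sf.
rewrite (_ : (fun x => _) =
  (fun x => (cmap (mchart b.2) \o cinv (mchart a.2)) x 0 k) \o rsubmx).
  apply: sf => x; rewrite cimg_prod_chart => -[[? ?] [? ?]]; by split.
by apply/funext => x /=; rewrite row_mxEr.
Qed.

Definition prod_manifold : manifold R (n + m) :=
  Manifold nonempty
    (hausdorff_prod (@points_hausdorff _ _ M) (@points_hausdorff _ _ N))
    (second_countable_prod (@points_second_countable _ _ M)
       (@points_second_countable _ _ N))
    (connected_prod (@points_connected _ _ M) (@points_connected _ _ N))
    cover smooth.

End product_manifold.

Section warped_product.
Variables (R : realType) (n m : nat).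
Variables (B : riemannian R n) (F : riemannian R m) (u : B -> R).
Hypothesis u_smooth : smooth_fun u.
Hypothesis u_pos : forall p, 0 < u p.

(* In a product chart the projections onto B and F are [lsubmx] and [rsubmx], so
   this is the coordinate expression of
   $\pi_B^* g_B + (u \circ \pi_B)^2 \pi_F^* g_F$. *)
Definition warped_metric (a : atlas (prod_manifold B F)) :
    'rV[R]_(n + m) -> 'M[R]_(n + m) := fun z =>
  pull lsubmx (metric a.1) z
  + (local_fun u a.1 (lsubmx z)) ^+ 2 *: pull rsubmx (metric a.2) z.

Lemma warped_metricE a z : warped_metric a z =
  block_mx (metric a.1 (lsubmx z)) 0
    0 ((local_fun u a.1 (lsubmx z)) ^+ 2 *: metric a.2 (rsubmx z)).
Proof.
rewrite /warped_metric pull_lsub pull_rsub scale_block_mx !scaler0.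
by rewrite add_block_mx !addr0 !add0r.
Qed.

Let dom_open (a : atlas (prod_manifold B F)) : open (cimg (mchart a)).
Proof. exact: cimg_open. Qed.

Let warped_smooth a i j :
  smooth_on (cimg (mchart a)) (fun z => warped_metric a z i j).
Proof.
under eq_fun do rewrite warped_metricE.
have subl : cimg (mchart a) `<=` lsubmx @^-1` cimg (mchart a.1).
  by rewrite cimg_prod_chart => z [].
have subr : cimg (mchart a) `<=` rsubmx @^-1` cimg (mchart a.2).
  by rewrite cimg_prod_chart => z [].
have su := subset_smooth_on subl (smooth_on_lsub (m := m) (@u_smooth a.1)).
have [k ->|k ->] := split_ordP i; have [l ->|l ->] := split_ordP j.
- under eq_fun do rewrite block_mxEul.
  exact: subset_smooth_on subl (smooth_on_lsub (@metric_smooth _ _ _ _ k l)).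
- under eq_fun do rewrite block_mxEur mxE.
  exact: smooth_on0.
- under eq_fun do rewrite block_mxEdl mxE.
  exact: smooth_on0.
- under eq_fun do rewrite block_mxEdr mxE expr2.
  apply: smooth_onM => //; first exact: smooth_onM.
  exact: subset_smooth_on subr (smooth_on_rsub (@metric_smooth _ _ _ _ k l)).
Qed.

Let warped_sym a z : cimg (mchart a) z ->
  (warped_metric a z)^T = warped_metric a z.
Proof.
rewrite cimg_prod_chart => -[lz rz].
by rewrite warped_metricE tr_block_mx !trmx0 linearZ /= !metric_sym.
Qed.

Let warped_pos a z : cimg (mchart a) z -> forall v : 'rV[R]_(n + m), v != 0 ->
  0 < (v *m warped_metric a z *m v^T) 0 0.
Proof.
rewrite cimg_prod_chart => -[lz rz] v; rewrite warped_metricE.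
rewrite -[v]hsubmxK; move: (lsubmx v) (rsubmx v) => x y.
rewrite tr_row_mx mul_row_block !mulmx0 addr0 add0r mul_row_col mxE.
rewrite -scalemxAr -scalemxAl [X in _ + X]mxE => xy0.
have u2 : 0 < (local_fun u a.1 (lsubmx z)) ^+ 2.
  by rewrite exprn_gt0 //; exact: u_pos.
have [x0|x0] := eqVneq x 0; have [y0|y0] := eqVneq y 0.
- by rewrite x0 y0 row_mx0 eqxx in xy0.
- by rewrite x0 !mul0mx mxE add0r mulr_gt0 // metric_pos.
- by rewrite y0 !mul0mx [X in _ * X]mxE mulr0 addr0 metric_pos.
- apply: addr_gt0; first exact: metric_pos.
  by apply: mulr_gt0 => //; exact: metric_pos.
Qed.

Let warped_change a b z : cimg (mchart a) z ->
  cdom (mchart b) (cinv (mchart a) z) ->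
  warped_metric a z =
    pull (cmap (mchart b) \o cinv (mchart a)) (warped_metric b) z.
Proof.
move=> az bz; set tau := _ \o _.
have dtau : differentiable tau z.
  exact: (smooth_map_diff (@atlas_smooth _ _ (prod_manifold B F) a b)).
move: (az); rewrite cimg_prod_chart => -[lz rz].
have [blz brz] : cdom (mchart b.1) (cinv (mchart a.1) (lsubmx z)) /\
  cdom (mchart b.2) (cinv (mchart a.2) (rsubmx z)) := bz.
have dl x : differentiable (@lsubmx R 1 n m) x := differentiable_lsubmx _.
have dr x : differentiable (@rsubmx R 1 n m) x := differentiable_rsubmx _.
have lE : pull lsubmx (metric a.1) z = pull tau (pull lsubmx (metric b.1)) z.
  rewrite -(pull_comp (metric b.1) dtau (dl (tau z))).
  rewrite (_ : lsubmx \o tau =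
    (cmap (mchart b.1) \o cinv (mchart a.1)) \o lsubmx); last first.
    by apply/funext => x; rewrite /= row_mxKl.
  have dt : differentiable (cmap (mchart b.1) \o cinv (mchart a.1)) (lsubmx z).
    exact: (smooth_map_diff (@atlas_smooth _ _ B a.1 b.1)).
  rewrite (pull_comp (metric b.1) (dl z) dt).
  by rewrite [LHS]/pull (metric_change lz blz).
have rE : pull rsubmx (metric a.2) z = pull tau (pull rsubmx (metric b.2)) z.
  rewrite -(pull_comp (metric b.2) dtau (dr (tau z))).
  rewrite (_ : rsubmx \o tau =
    (cmap (mchart b.2) \o cinv (mchart a.2)) \o rsubmx); last first.
    by apply/funext => x; rewrite /= row_mxKr.
  have dt : differentiable (cmap (mchart b.2) \o cinv (mchart a.2)) (rsubmx z).
    exact: (smooth_map_diff (@atlas_smooth _ _ F a.2 b.2)).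
  rewrite (pull_comp (metric b.2) (dr z) dt).
  by rewrite [LHS]/pull (metric_change rz brz).
have uE : local_fun u a.1 (lsubmx z) = local_fun u b.1 (lsubmx (tau z)).
  by rewrite /local_fun /= row_mxKl cmapK.
rewrite /warped_metric lE rE uE /pull.
by rewrite mulmxDr mulmxDl -scalemxAr -scalemxAl.
Qed.

Definition warped_product : riemannian R (n + m) :=
  @Riemannian R (n + m) (prod_manifold B F) warped_metric
    warped_smooth warped_sym warped_pos warped_change.

End warped_product.

(* Main.v *)
Require Import Defs.
From HB Require Import structures.
From mathcomp Require Import all_boot all_order all_algebra.
From mathcomp Require Import all_classical all_reals all_analysis.
From mathcomp Require Import ring.
Import Order.TTheory GRing.Theory Num.Theory numFieldNormedType.Exports.
Local Open Scope classical_set_scope.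
Local Open Scope ring_scope.

Set Implicit Arguments.
Unset Strict Implicit.
Unset Printing Implicit Defensive.

(** The statement is local, so it is enough to compute the Ricci tensor of
    $g + f^2 h$ on an open subset of $R^n \times R^m$, where $g$ depends on the
    first group of coordinates, $h$ on the second and $f > 0$ is the coordinate
    expression of $u$.  The result is the classical block formula
    - on the base, $Ric_g - (m / f) \nabla^2 f$ (ricci_warped_base);
    - on the mixed blocks, 0 (ricci_warped_base_fibre and
      ricci_warped_fibre_base);
    - on the fibre, $Ric_h - (f \Delta f + (m - 1) |\nabla f|^2) h$
      (ricci_warped_fibre).

    The soliton equation says that the base block is $\lambda g$.  Since
    $Ric_h = \mu h$ and $\mu = \lambda f^2 + f \Delta f + (m - 1) |\nabla f|^2$,
    the fibre block is $\lambda f^2 h$.  Together these are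
    $\lambda (g + f^2 h)$.

    The block formula is obtained from the Christoffel symbols of the warped
    metric, each of which is either zero, a symbol of one factor, or an explicit
    product of a function of the base and a function of the fibre.  In the fibre
    block the Laplacian appears as the divergence of the gradient, whereas it is
    defined as the trace of the Hessian; divergence_gradient reconciles the two,
    and this is where the derivative of the inverse metric is needed
    (pd_invmx). *)

(** * Partial derivatives *)

Section partial_derivatives.
Context {R : realType} {n : nat}.
Implicit Types (f g : 'rV[R]_n -> R) (x : 'rV[R]_n) (i : 'I_n).

Definition pderivable i f x := derivable f x (delta_mx 0 i).

Lemma smooth_pderivable A f x i : smooth_on A f -> A x -> pderivable i f x.
Proof. by move=> sf Ax; apply: diff_derivable; exact: smooth_on_diff sf Ax. Qed.

Lemma smooth_pd_pderivable A f x i j :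
  smooth_on A f -> A x -> pderivable i (pd j f) x.
Proof. by move=> sf; apply: smooth_pderivable; exact: smooth_on_pd. Qed.

Lemma pderivable_cst (c : R) i x : pderivable i (fun=> c) x.
Proof. exact: derivable_cst. Qed.

Lemma pd_cst (c : R) i x : pd i (fun=> c) x = 0.
Proof. exact: derive_cst. Qed.

Lemma pderivableM f g i x : pderivable i f x -> pderivable i g x ->
  pderivable i (fun y => f y * g y) x.
Proof. exact: derivableM. Qed.

Lemma pdM f g i x : pderivable i f x -> pderivable i g x ->
  pd i (fun y => f y * g y) x = pd i f x * g x + f x * pd i g x.
Proof.
move=> df dg; rewrite /pd [LHS](deriveM df dg) addrC.
by rewrite [X in X + _]mulrC.
Qed.

Lemma pdMl (c : R) f i x : pderivable i f x ->
  pd i (fun y => c * f y) x = c * pd i f x.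
Proof.
move=> df; rewrite (pdM (@pderivable_cst c i x) df).
by rewrite pd_cst mul0r add0r.
Qed.

Lemma pdV f i x : f x != 0 -> pderivable i f x ->
  pd i (fun y => (f y)^-1) x = - (pd i f x / f x ^+ 2).
Proof.
move=> fx df; rewrite [LHS](deriveV fx df) scaleNr.
by rewrite /GRing.scale /= mulrC.
Qed.

Lemma pderivable_sum (I : Type) (r : seq I) (F : I -> 'rV[R]_n -> R) i x :
  (forall k, pderivable i (F k) x) ->
  pderivable i (fun y => \sum_(k <- r) F k y) x.
Proof.
move=> dF; elim: r => [|k r IH].
  by under eq_fun do rewrite big_nil; exact: pderivable_cst.
under eq_fun do rewrite big_cons.
by apply: derivableD; [exact: dF | exact: IH].
Qed.

Lemma pd_sum (I : Type) (r : seq I) (F : I -> 'rV[R]_n -> R) i x :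
  (forall k, pderivable i (F k) x) ->
  pd i (fun y => \sum_(k <- r) F k y) x = \sum_(k <- r) pd i (F k) x.
Proof.
move=> dF; elim: r => [|k r IH].
  by under eq_fun do rewrite big_nil; rewrite pd_cst big_nil.
under eq_fun do rewrite big_cons.
rewrite big_cons -IH [LHS]deriveD //; first exact: dF.
exact: pderivable_sum.
Qed.

Lemma pderivable_prod (I : Type) (r : seq I) (F : I -> 'rV[R]_n -> R) i x :
  (forall k, pderivable i (F k) x) ->
  pderivable i (fun y => \prod_(k <- r) F k y) x.
Proof.
move=> dF; elim: r => [|k r IH].
  by under eq_fun do rewrite big_nil; exact: pderivable_cst.
by under eq_fun do rewrite big_cons; exact: (pderivableM (dF k) IH).
Qed.

Lemma eq_pd_near f g i x : (\forall y \near x, f y = g y) ->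
  pd i f x = pd i g x.
Proof. exact: near_eq_derive. Qed.

Lemma eq_pd_on A f g i x : open A -> A x -> (forall y, A y -> f y = g y) ->
  pd i f x = pd i g x.
Proof.
move=> oA Ax fg; apply: eq_pd_near.
by apply: filterS (open_nbhs_nbhs (conj oA Ax)).
Qed.

Lemma eq_pderivable_on A f g i x : open A -> A x ->
  (forall y, A y -> f y = g y) -> pderivable i f x -> pderivable i g x.
Proof.
move=> oA Ax fg; apply: near_eq_derivable.
by apply: filterS (open_nbhs_nbhs (conj oA Ax)).
Qed.

Lemma pderivable_det k (A : 'rV[R]_n -> 'M[R]_k) i x :
  (forall a b, pderivable i (fun y => A y a b) x) ->
  pderivable i (fun y => \det (A y)) x.
Proof.
move=> dA; apply: pderivable_sum => s; apply: pderivableM.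
  exact: pderivable_cst.
by apply: pderivable_prod.
Qed.

(** By Cramer's rule an entry of the inverse is a rational function of the
    entries of the matrix. *)
Lemma pderivable_invmx k (U : set 'rV[R]_n) (A : 'rV[R]_n -> 'M[R]_k) i x a b :
  open U -> U x -> (forall y, U y -> A y \in unitmx) ->
  (forall a b, pderivable i (fun y => A y a b) x) ->
  pderivable i (fun y => invmx (A y) a b) x.
Proof.
move=> oU Ux uA dA.
apply: (@eq_pderivable_on U
  (fun y => (\det (A y))^-1 * cofactor (A y) b a)) => //.
  by move=> y /uA uAy; rewrite /invmx uAy !mxE.
apply: pderivableM.
  apply: derivableV; last exact: pderivable_det.
  by have := uA _ Ux; rewrite unitmxE unitfE.
apply: pderivableM; first exact: pderivable_cst.
apply: pderivable_det => c d.
by under eq_fun do rewrite !mxE; exact: dA.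
Qed.

(** Differentiate $A^{-1} A = 1$, which holds near [x] because $A$ is invertible
    on an open set. *)
Lemma pd_invmx k (U : set 'rV[R]_n) (A : 'rV[R]_n -> 'M[R]_k) i x a b :
  open U -> U x -> (forall y, U y -> A y \in unitmx) ->
  (forall a b, pderivable i (fun y => A y a b) x) ->
  pd i (fun y => invmx (A y) a b) x =
  - \sum_c \sum_d invmx (A x) a c * pd i (fun y => A y c d) x * invmx (A x) d b.
Proof.
move=> oU Ux uA dA.
pose dI := \matrix_(a, b) pd i (fun y => invmx (A y) a b) x.
pose D := \matrix_(a, b) pd i (fun y => A y a b) x.
have dinv a' b' : pderivable i (fun y => invmx (A y) a' b') x.
  exact: pderivable_invmx oU Ux uA dA.
suff E : dI *m A x + invmx (A x) *m D = 0.
  have -> : pd i (fun y => invmx (A y) a b) x = dI a b by rewrite mxE.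
  have -> : dI = - (invmx (A x) *m D *m invmx (A x)).
    have /(congr1 (mulmx^~ (invmx (A x)))) := E.
    by rewrite mulmxDl mulmxK ?uA // mul0mx => /eqP; rewrite addr_eq0 => /eqP.
  rewrite mxE; congr (- _); rewrite mxE exchange_big; apply: eq_bigr => d _ /=.
  by rewrite mxE mulr_suml; apply: eq_bigr => c _; rewrite mxE.
apply/matrixP => p q; rewrite !mxE -big_split /=.
transitivity (pd i (fun y => \sum_c invmx (A y) p c * A y c q) x).
  rewrite pd_sum => [|c]; last exact: pderivableM.
  by apply: eq_bigr => c _; rewrite pdM // !mxE.
rewrite (@eq_pd_on U _ (fun=> (1%:M : 'M[R]_k) p q)) ?pd_cst // => y Uy.
by rewrite -(mulVmx (uA _ Uy)) mxE.
Qed.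

End partial_derivatives.

(** * The divergence of a gradient *)

Section local_metric.
Context {R : realType} {n : nat}.
Implicit Types (U : set 'rV[R]_n) (g : 'rV[R]_n -> 'M[R]_n) (f : 'rV[R]_n -> R).

(** The coordinate expression of a pseudo-Riemannian metric in one chart.
    Curvature involves the inverse metric, so positivity is used in the form of
    invertibility. *)
Definition local_metric U g : Prop :=
  [/\ open U, forall i j, smooth_on U (fun x => g x i j),
      forall x, U x -> (g x)^T = g x & forall x, U x -> g x \in unitmx].

Section local_metric_facts.
Variables (U : set 'rV[R]_n) (g : 'rV[R]_n -> 'M[R]_n).
Hypothesis Ug : local_metric U g.
Let oU : open U. Proof. by case: Ug. Qed.

Lemma metric_pderivable x l i j : U x -> pderivable l (fun y => g y i j) x.
Proof. by case: Ug => _ sg _ _; exact: smooth_pderivable. Qed.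

Lemma metricC x i j : U x -> g x i j = g x j i.
Proof. by case: Ug => _ _ tg _ /tg {1}<-; rewrite mxE. Qed.

Lemma pd_metricC x l i j : U x ->
  pd l (fun y => g y i j) x = pd l (fun y => g y j i) x.
Proof.
move=> Ux; apply: (@eq_pd_on _ _ U _ _ l) => // y.
exact: metricC.
Qed.

Lemma inv_metricC x i j : U x -> invmx (g x) i j = invmx (g x) j i.
Proof. by case: Ug => _ _ tg _ /tg gx; rewrite -{1}gx -trmx_inv mxE. Qed.

Lemma inv_metric_pderivable x l i j : U x ->
  pderivable l (fun y => invmx (g y) i j) x.
Proof.
case: (Ug) => _ _ _ ug Ux; apply: (@pderivable_invmx _ _ _ U) => // a b.
exact: metric_pderivable.
Qed.

Lemma christoffelC x k i j : U x ->
  christoffel g k i j x = christoffel g k j i x.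
Proof.
move=> Ux; congr (_ * _); apply: eq_bigr => l _; congr (_ * _).
rewrite [X in _ = X - _]addrC; congr (_ - _); last exact: pd_metricC.
Qed.

Variable f : 'rV[R]_n -> R.
Hypothesis sf : smooth_on U f.

Lemma gradient_pderivable x l i : U x ->
  pderivable l (fun y => gradient g f y 0 i) x.
Proof.
move=> Ux; rewrite (_ : (fun _ => _) =
    fun y => \sum_(j < n) invmx (g y) i j * pd j f y); last first.
  by apply/funext => y; rewrite mxE.
apply: pderivable_sum => j; apply: pderivableM.
  exact: inv_metric_pderivable.
exact: smooth_pd_pderivable sf Ux.
Qed.

(** The divergence of a vector field $w$ is $\partial_i w^i +
    \Gamma^i_{ip} w^p$.  Write $D_{l,ij} = \partial_l g_{ij}$, $w = \nabla f$
    and $H = g^{ij} \partial_i \partial_j f$.  Then $\partial_i w^i = H - A$ by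
    the formula for the derivative of an inverse, where
    $A = g^{ij} D_{i,jl} w^l$, and $\Gamma^i_{ip} w^p = S / 2$, where
    $S = g^{ij} D_{l,ij} w^l$, because the other two terms of the Christoffel
    symbol cancel under $i \leftrightarrow l$.  The trace of the Hessian is
    $H - g^{ij} \Gamma^k_{ij} \partial_k f = H - A + S / 2$ as well. *)
Lemma divergence_gradient x : U x ->
  \sum_(i < n) pd i (fun y => gradient g f y 0 i) x
  + \sum_(i < n) \sum_(p < n) christoffel g i i p x * gradient g f x 0 p
  = laplacian g f x.
Proof.
move=> Ux; case: (Ug) => _ _ _ ug.
pose Gi := invmx (g x); pose D l i j := pd l (fun y => g y i j) x.
pose w p := gradient g f x 0 p.
have GiC i j : Gi i j = Gi j i by exact: inv_metricC.
have DC l i j : D l i j = D l j i by exact: pd_metricC.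
have wE p : \sum_j Gi p j * pd j f x = w p by rewrite /w mxE.
pose A := \sum_l \sum_i \sum_j Gi i j * D i j l * w l.
pose S := \sum_l \sum_i \sum_j Gi i j * D l i j * w l.
pose H := \sum_i \sum_j Gi i j * pd i (pd j f) x.
have -> : \sum_(i < n) pd i (fun y => gradient g f y 0 i) x = H - A.
  transitivity (\sum_i ((\sum_j Gi i j * pd i (pd j f) x)
     - \sum_j \sum_l Gi i j * D i j l * w l)).
    apply: eq_bigr => i _.
    rewrite (_ : (fun _ => _) =
      fun y => \sum_(j < n) invmx (g y) i j * pd j f y); last first.
      by apply/funext => y; rewrite mxE.
    rewrite pd_sum => [|j]; last first.
      apply: pderivableM; first exact: inv_metric_pderivable.
      exact: smooth_pd_pderivable sf Ux.
    transitivity (\sum_j (Gi i j * pd i (pd j f) x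
       - \sum_c \sum_d Gi i c * D i c d * Gi d j * pd j f x)).
      apply: eq_bigr => j _; rewrite pdM; last 2 first.
      - exact: inv_metric_pderivable.
      - exact: smooth_pd_pderivable sf Ux.
      rewrite (@pd_invmx _ _ _ U) //; last first.
        by move=> a b; exact: metric_pderivable.
      rewrite addrC mulNr; congr (_ - _).
      by rewrite mulr_suml; apply: eq_bigr => c _; rewrite mulr_suml.
    rewrite sumrB; congr (_ - _).
    rewrite exchange_big; apply: eq_bigr => c _ /=.
    rewrite exchange_big; apply: eq_bigr => d _ /=.
    by rewrite -wE mulr_sumr; apply: eq_bigr => j _; rewrite mulrA.
  rewrite sumrB; congr (_ - _); rewrite /A.
  under eq_bigr do rewrite exchange_big /=.
  by rewrite exchange_big.
have -> : \sum_(i < n) \sum_(p < n) christoffel g i i p x * gradient g f x 0 p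
    = 2^-1 * S.
  rewrite exchange_big mulr_sumr; apply: eq_bigr => p _ /=.
  transitivity (2^-1 * \sum_i \sum_l
      (Gi i l * D p i l * w p
       + (Gi i l * D i p l * w p - Gi i l * D l i p * w p))).
    rewrite mulr_sumr; apply: eq_bigr => i _.
    rewrite /christoffel -mulrA mulr_suml; congr (_ * _).
    by apply: eq_bigr => l _; rewrite -/(w p) /D /Gi; ring.
  congr (_ * _); under [LHS]eq_bigr do rewrite big_split sumrB /=.
  rewrite big_split sumrB /= [X in _ + (X - _)]exchange_big /=.
  rewrite [X in _ + (X - _)](_ : _ = \sum_i \sum_l Gi i l * D l i p * w p).
    by rewrite subrr addr0.
  by apply: eq_bigr => i _; apply: eq_bigr => l _; rewrite GiC DC.
transitivity (H - \sum_l \sum_i \sum_j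
   (Gi i j * D i j l * w l - 2^-1 * (Gi i j * D l i j * w l))).
  under [X in _ = _ - X]eq_bigr do under eq_bigr do rewrite sumrB -mulr_sumr.
  under [X in _ = _ - X]eq_bigr do rewrite sumrB -mulr_sumr.
  by rewrite sumrB -mulr_sumr -/A -/S; ring.
rewrite /laplacian /mxtrace.
transitivity (\sum_i \sum_j (Gi i j * pd i (pd j f) x
   - \sum_k Gi i j * christoffel g k i j x * pd k f x)).
  under [RHS]eq_bigr do rewrite sumrB.
  rewrite sumrB; congr (_ - _).
  transitivity (\sum_i \sum_j \sum_l
    Gi i j * (2^-1 * (D i j l + D j i l - D l i j)) * w l); last first.
    apply: eq_bigr => i _; apply: eq_bigr => j _.
    under [RHS]eq_bigr do rewrite /christoffel mulr_sumr mulr_sumr mulr_suml.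
    rewrite exchange_big; apply: eq_bigr => l _ /=.
    rewrite -wE mulr_sumr; apply: eq_bigr => k _.
    by rewrite (GiC l k) /D /Gi; ring.
  transitivity (\sum_l \sum_i \sum_j
    Gi i j * (2^-1 * (D i j l + D j i l - D l i j)) * w l); last first.
    rewrite exchange_big /=; apply: eq_bigr => i _.
    by rewrite exchange_big.
  apply: eq_bigr => l _.
  transitivity (\sum_i \sum_j (2^-1 * (Gi i j * D i j l * w l) +
    2^-1 * (Gi i j * D j i l * w l) - 2^-1 * (Gi i j * D l i j * w l))).
    transitivity (\sum_i \sum_j (2^-1 * (Gi i j * D i j l * w l) +
       (2^-1 * (Gi i j * D i j l * w l) - 2^-1 * (Gi i j * D l i j * w l)))).
      by apply: eq_bigr => i _; apply: eq_bigr => j _; field.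
    under [LHS]eq_bigr do rewrite big_split sumrB /=.
    under [RHS]eq_bigr do rewrite sumrB big_split /=.
    rewrite big_split sumrB [RHS]sumrB big_split /= addrA.
    congr (_ + _ - _); rewrite exchange_big; apply: eq_bigr => i _ /=.
    by apply: eq_bigr => j _; rewrite GiC.
  by apply: eq_bigr => i _; apply: eq_bigr => j _; ring.
under [RHS]eq_bigr do rewrite mxE.
rewrite exchange_big; apply: eq_bigr => j _; apply: eq_bigr => i _ /=.
rewrite [hessian _ _ _ _ _]mxE -/Gi (GiC i j) mulrBr mulr_sumr.
by congr (_ - _); apply: eq_bigr => k _; rewrite [RHS]mulrA.
Qed.

End local_metric_facts.
End local_metric.

(** * Partial derivatives on a product *)

Section product_partial_derivatives.
Context {R : realType} {n m : nat}.
Implicit Types (F : 'rV[R]_(n + m) -> R) (z : 'rV[R]_(n + m)).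
Implicit Types (phi : 'rV[R]_n -> R) (psi : 'rV[R]_m -> R).

(** A partial derivative only sees the slice through the point, so the
    coordinates of the other factor may be treated as constants. *)
Lemma pd_lshift F i z :
  pd (lshift m i) F z = pd i (fun x => F (row_mx x (rsubmx z))) (lsubmx z).
Proof.
rewrite /pd /derive /= hsubmxK; do 2 f_equal.
apply/funext => t /=; congr (_ *: (F _ - _)).
rewrite -[LHS]hsubmxK; congr row_mx; apply/rowP => j.
  by rewrite !mxE eqxx (inj_eq (@lshift_inj _ _)).
by rewrite !mxE eqxx /= eq_rlshift mulr0 add0r.
Qed.

Lemma pd_rshift F i z :
  pd (rshift n i) F z = pd i (fun y => F (row_mx (lsubmx z) y)) (rsubmx z).
Proof.
rewrite /pd /derive /= hsubmxK; do 2 f_equal.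
apply/funext => t /=; congr (_ *: (F _ - _)).
rewrite -[LHS]hsubmxK; congr row_mx; apply/rowP => j.
  by rewrite !mxE eqxx /= eq_lrshift mulr0 add0r.
by rewrite !mxE eqxx (inj_eq (@rshift_inj _ _)).
Qed.

Lemma pd_lshiftM phi psi i z : pderivable i phi (lsubmx z) ->
  pd (lshift m i) (fun y => phi (lsubmx y) * psi (rsubmx y)) z
  = pd i phi (lsubmx z) * psi (rsubmx z).
Proof.
move=> dphi; rewrite pd_lshift.
under eq_fun do rewrite row_mxKl row_mxKr mulrC.
by rewrite pdMl // mulrC.
Qed.

Lemma pd_rshiftM phi psi i z : pderivable i psi (rsubmx z) ->
  pd (rshift n i) (fun y => phi (lsubmx y) * psi (rsubmx y)) z
  = phi (lsubmx z) * pd i psi (rsubmx z).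
Proof.
move=> dpsi; rewrite pd_rshift.
under eq_fun do rewrite row_mxKl row_mxKr.
by rewrite pdMl.
Qed.

End product_partial_derivatives.

(** * Curvature of a warped product *)

Section warped_curvature.
Context {R : realType} {n m : nat}.
Variables (U : set 'rV[R]_n) (V : set 'rV[R]_m).
Variables (g : 'rV[R]_n -> 'M[R]_n) (h : 'rV[R]_m -> 'M[R]_m).
Variable f : 'rV[R]_n -> R.
Hypotheses (Ug : local_metric U g) (Vh : local_metric V h).
Hypotheses (sf : smooth_on U f) (f_neq0 : forall x, U x -> f x != 0).

Definition warped (z : 'rV[R]_(n + m)) : 'M[R]_(n + m) :=
  block_mx (g (lsubmx z)) 0 0 (f (lsubmx z) ^+ 2 *: h (rsubmx z)).

Definition warped_dom : set 'rV[R]_(n + m) :=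
  lsubmx @^-1` U `&` rsubmx @^-1` V.

Local Notation W := warped.
Local Notation l i := (lshift m i).
Local Notation r a := (rshift n a).
Implicit Types (i j k p q : 'I_n) (a b c d : 'I_m) (I J K : 'I_(n + m)).
Implicit Types (z : 'rV[R]_(n + m)).

Let warped_ll i j : (fun z => W z (l i) (l j)) = (fun x => g x i j) \o lsubmx.
Proof. by apply/funext => z; rewrite /W block_mxEul. Qed.

Let warped_lr i b : (fun z => W z (l i) (r b)) = fun=> 0.
Proof. by apply/funext => z; rewrite /W block_mxEur mxE. Qed.

Let warped_rl a j : (fun z => W z (r a) (l j)) = fun=> 0.
Proof. by apply/funext => z; rewrite /W block_mxEdl mxE. Qed.

Let warped_rr a b : (fun z => W z (r a) (r b)) =
  fun z => (fun x => f x ^+ 2) (lsubmx z) * (fun y => h y a b) (rsubmx z).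
Proof. by apply/funext => z; rewrite /W block_mxEdr mxE. Qed.

Lemma open_warped_dom : open warped_dom.
Proof.
case: Ug Vh => oU _ _ _ [oV _ _ _]; apply: openI; apply: open_comp => //.
  by move=> z _; exact: continuous_lsubmx.
by move=> z _; exact: continuous_rsubmx.
Qed.

Let f_pderivable i x : U x -> pderivable i f x.
Proof. exact: smooth_pderivable. Qed.

Let pd_warped_ll_l k i j z : pd (l k) (fun z => W z (l i) (l j)) z
  = pd k (fun x => g x i j) (lsubmx z).
Proof. by rewrite warped_ll pd_lsub_l. Qed.

Let pd_warped_ll_r c i j z : pd (r c) (fun z => W z (l i) (l j)) z = 0.
Proof. by rewrite warped_ll pd_lsub_r. Qed.

Let pd_warped_lr K i b z : pd K (fun z => W z (l i) (r b)) z = 0.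
Proof. by rewrite warped_lr pd_cst. Qed.

Let pd_warped_rl K a j z : pd K (fun z => W z (r a) (l j)) z = 0.
Proof. by rewrite warped_rl pd_cst. Qed.

Let pd_warped_rr_l k a b z : warped_dom z ->
  pd (l k) (fun z => W z (r a) (r b)) z
  = 2 * f (lsubmx z) * pd k f (lsubmx z) * h (rsubmx z) a b.
Proof.
move=> [Uz Vz]; rewrite warped_rr (@pd_lshiftM _ _ _ (fun x => f x ^+ 2)
    (fun y => h y a b)); last first.
  by apply: pderivableM; exact: f_pderivable.
congr (_ * _); rewrite [LHS]pdM; try exact: f_pderivable.
by ring.
Qed.

Let pd_warped_rr_r c a b z : warped_dom z ->
  pd (r c) (fun z => W z (r a) (r b)) z
  = f (lsubmx z) ^+ 2 * pd c (fun y => h y a b) (rsubmx z).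
Proof.
move=> [Uz Vz]; rewrite warped_rr (@pd_rshiftM _ _ _ (fun x => f x ^+ 2)
    (fun y => h y a b)) //.
exact: (metric_pderivable Vh Vz).
Qed.

Let inv_warped z : warped_dom z -> invmx (W z) =
  block_mx (invmx (g (lsubmx z))) 0
           0 ((f (lsubmx z) ^+ 2)^-1 *: invmx (h (rsubmx z))).
Proof.
case: Ug Vh => _ _ _ ug [_ _ _ uh] [/= Uz Vz].
have u2 : f (lsubmx z) ^+ 2 *: h (rsubmx z) \in unitmx.
  by rewrite unitmxZ ?uh // unitfE expf_neq0 // f_neq0.
rewrite invmx_block_diag ?invmxZ // block_diag_mx_unit u2 andbT.
exact: ug.
Qed.

Let christoffel_l k I J z : warped_dom z -> christoffel W (l k) I J z =
  2^-1 * \sum_p invmx (g (lsubmx z)) k p *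
    (pd I (fun y => W y J (l p)) z + pd J (fun y => W y I (l p)) z
     - pd (l p) (fun y => W y I J) z).
Proof.
move=> Wz; rewrite /christoffel inv_warped // big_split_ord /=; congr (_ * _).
rewrite [X in _ + X]big1 => [|d _]; last by rewrite block_mxEur mxE mul0r.
by rewrite addr0; apply: eq_bigr => p _; rewrite block_mxEul.
Qed.

Let christoffel_r c I J z : warped_dom z -> christoffel W (r c) I J z =
  2^-1 * \sum_d (f (lsubmx z) ^+ 2)^-1 * invmx (h (rsubmx z)) c d *
    (pd I (fun y => W y J (r d)) z + pd J (fun y => W y I (r d)) z
     - pd (r d) (fun y => W y I J) z).
Proof.
move=> Wz; rewrite /christoffel inv_warped // big_split_ord /=; congr (_ * _).
rewrite [X in X + _]big1 => [|d _]; last by rewrite block_mxEdl mxE mul0r.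
by rewrite add0r; apply: eq_bigr => p _; rewrite block_mxEdr mxE.
Qed.

Let sum_delta (c : 'I_m) (F : 'I_m -> R) : \sum_d (c == d)%:R * F d = F c.
Proof.
rewrite (bigD1 c) //= eqxx mul1r big1 ?addr0 // => d /negPf dc.
by rewrite eq_sym dc mul0r.
Qed.

(** In the names below, [l] stands for an index of the base and [r] for one of
    the fibre; the letters follow the order of the indices of $\Gamma^k_{ij}$.
    The only components that mix the factors and survive are
    $\Gamma^k_{ab} = - f f^k h_{ab}$ and
    $\Gamma^c_{ib} = \Gamma^c_{bi} = \delta^c_b \, \partial_i f / f$. *)
Lemma christoffel_lll k i j z : warped_dom z ->
  christoffel W (l k) (l i) (l j) z = christoffel g k i j (lsubmx z).
Proof.
move=> Wz; rewrite christoffel_l //; congr (_ * _); apply: eq_bigr => p _.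
by rewrite !pd_warped_ll_l.
Qed.

Lemma christoffel_llr k i b z : warped_dom z ->
  christoffel W (l k) (l i) (r b) z = 0.
Proof.
move=> Wz; rewrite christoffel_l // big1 ?mulr0 // => p _.
by rewrite pd_warped_rl pd_warped_ll_r pd_warped_lr addr0 subr0 mulr0.
Qed.

Lemma christoffel_lrl k a j z : warped_dom z ->
  christoffel W (l k) (r a) (l j) z = 0.
Proof.
move=> Wz; rewrite christoffel_l // big1 ?mulr0 // => p _.
by rewrite !pd_warped_rl pd_warped_ll_r addr0 subr0 mulr0.
Qed.

Lemma christoffel_lrr k a b z : warped_dom z ->
  christoffel W (l k) (r a) (r b) z =
  - (f (lsubmx z) * gradient g f (lsubmx z) 0 k * h (rsubmx z) a b).
Proof.
move=> Wz; rewrite christoffel_l // mxE mulr_sumr mulr_sumr mulr_suml -sumrN.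
apply: eq_bigr => p _; rewrite !pd_warped_rl pd_warped_rr_l //.
by field.
Qed.

Lemma christoffel_rll c i j z : warped_dom z ->
  christoffel W (r c) (l i) (l j) z = 0.
Proof.
move=> Wz; rewrite christoffel_r // big1 ?mulr0 // => p _.
by rewrite !pd_warped_lr pd_warped_ll_r addr0 subr0 mulr0.
Qed.

Lemma christoffel_rlr c i b z : warped_dom z ->
  christoffel W (r c) (l i) (r b) z =
  (c == b)%:R * (pd i f (lsubmx z) / f (lsubmx z)).
Proof.
move=> Wz; case: (Wz) => Uz Vz; rewrite christoffel_r //.
have fz := f_neq0 Uz; case: (Vh) => _ _ _ uh.
transitivity ((\sum_d invmx (h (rsubmx z)) c d * h (rsubmx z) d b)
    * (pd i f (lsubmx z) / f (lsubmx z))); last first.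
  by have := mulVmx (uh _ Vz) => /matrixP /(_ c b); rewrite !mxE => ->.
rewrite mulr_sumr mulr_suml; apply: eq_bigr => d _.
rewrite !pd_warped_lr pd_warped_rr_l // (metricC Vh b d Vz).
by field.
Qed.

Lemma christoffel_rrl c a j z : warped_dom z ->
  christoffel W (r c) (r a) (l j) z =
  (c == a)%:R * (pd j f (lsubmx z) / f (lsubmx z)).
Proof.
move=> Wz; rewrite -christoffel_rlr // !christoffel_r //; congr (_ * _).
apply: eq_bigr => d _; congr (_ * _).
by rewrite !pd_warped_lr pd_warped_rl addr0 add0r.
Qed.

Lemma christoffel_rrr c a b z : warped_dom z ->
  christoffel W (r c) (r a) (r b) z = christoffel h c a b (rsubmx z).
Proof.
move=> Wz; case: (Wz) => Uz Vz; rewrite christoffel_r // /christoffel.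
congr (_ * _); apply: eq_bigr => d _; rewrite !pd_warped_rr_r //.
by have fz := f_neq0 Uz; field.
Qed.

Let eq_pd_warped K F G z : warped_dom z ->
  (forall y, warped_dom y -> F y = G y) -> pd K F z = pd K G z.
Proof. by move=> Wz; exact: eq_pd_on open_warped_dom Wz. Qed.

Let pd_warped0 K F z : warped_dom z -> (forall y, warped_dom y -> F y = 0) ->
  pd K F z = 0.
Proof. by move=> Wz F0; rewrite (eq_pd_warped _ Wz F0) pd_cst. Qed.

(** The last letter is the factor of the direction of differentiation.  The
    closed forms of the Christoffel symbols hold on the open set [warped_dom],
    hence near each of its points, so they may be differentiated. *)
Lemma pd_christoffel_lll_l q k i j z : warped_dom z ->
  pd (l q) (christoffel W (l k) (l i) (l j)) z
  = pd q (christoffel g k i j) (lsubmx z).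
Proof.
move=> Wz; have := @pd_lsub_l R n m q (christoffel g k i j).
move=> /(congr1 (@^~ z)); apply: etrans; apply: (eq_pd_warped _ Wz) => y.
exact: christoffel_lll.
Qed.

Lemma pd_christoffel_lll_r d k i j z : warped_dom z ->
  pd (r d) (christoffel W (l k) (l i) (l j)) z = 0.
Proof.
move=> Wz; have := @pd_lsub_r R n m d (christoffel g k i j).
move=> /(congr1 (@^~ z)); apply: etrans; apply: (eq_pd_warped _ Wz) => y.
exact: christoffel_lll.
Qed.

Lemma pd_christoffel_lrr_l q k a b z : warped_dom z ->
  pd (l q) (christoffel W (l k) (r a) (r b)) z =
  - ((pd q f (lsubmx z) * gradient g f (lsubmx z) 0 k
      + f (lsubmx z) * pd q (fun x => gradient g f x 0 k) (lsubmx z))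
     * h (rsubmx z) a b).
Proof.
move=> Wz; case: (Wz) => Uz Vz.
have dG : pderivable q (fun x => gradient g f x 0 k) (lsubmx z).
  exact: (gradient_pderivable Ug sf Uz).
transitivity (pd (l q) (fun y =>
    (-1 * (f (lsubmx y) * gradient g f (lsubmx y) 0 k))
    * h (rsubmx y) a b) z).
  apply: (eq_pd_warped _ Wz) => y Wy.
  by rewrite (christoffel_lrr _ _ _ Wy) mulN1r mulNr.
rewrite (@pd_lshiftM _ _ _ (fun x => -1 * (f x * gradient g f x 0 k))
    (fun y => h y a b)); last first.
  apply: pderivableM; first exact: pderivable_cst.
  by apply: pderivableM; first exact: f_pderivable.
have df : pderivable q f (lsubmx z) := f_pderivable Uz.
by rewrite (pdMl _ (pderivableM df dG)) (pdM df dG) mulN1r mulNr.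
Qed.

Lemma pd_christoffel_rlr_l q c i b z : warped_dom z ->
  pd (l q) (christoffel W (r c) (l i) (r b)) z = (c == b)%:R *
  (pd q (pd i f) (lsubmx z) / f (lsubmx z)
   - pd q f (lsubmx z) * pd i f (lsubmx z) / f (lsubmx z) ^+ 2).
Proof.
move=> Wz; case: (Wz) => Uz Vz; have fz := f_neq0 Uz.
transitivity (pd (l q)
    ((fun x => (c == b)%:R * (pd i f x * (f x)^-1)) \o lsubmx) z).
  by apply: (eq_pd_warped _ Wz) => y Wy; rewrite (christoffel_rlr _ _ _ Wy).
have dV : pderivable q (fun x => (f x)^-1) (lsubmx z).
  by apply: derivableV => //; exact: f_pderivable.
have dd : pderivable q (pd i f) (lsubmx z) by exact: smooth_pd_pderivable sf Uz.
rewrite pd_lsub_l /= (pdMl _ (pderivableM dd dV)) (pdM dd dV).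
rewrite (pdV fz (f_pderivable Uz)) mulrN mulrA (mulrC (pd i f _)).
by congr (_ * _).
Qed.

Lemma pd_christoffel_rlr_r d c i b z : warped_dom z ->
  pd (r d) (christoffel W (r c) (l i) (r b)) z = 0.
Proof.
move=> Wz; transitivity (pd (r d)
    ((fun x => (c == b)%:R * (pd i f x * (f x)^-1)) \o lsubmx) z).
  by apply: (eq_pd_warped _ Wz) => y Wy; rewrite (christoffel_rlr _ _ _ Wy).
by rewrite pd_lsub_r.
Qed.

Lemma pd_christoffel_rrl_r d c a j z : warped_dom z ->
  pd (r d) (christoffel W (r c) (r a) (l j)) z = 0.
Proof.
move=> Wz; rewrite -(pd_christoffel_rlr_r d c j a Wz).
apply: (eq_pd_warped _ Wz) => y Wy.
by rewrite (christoffel_rlr _ _ _ Wy) (christoffel_rrl _ _ _ Wy).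
Qed.

Lemma pd_christoffel_rrr_l q c a b z : warped_dom z ->
  pd (l q) (christoffel W (r c) (r a) (r b)) z = 0.
Proof.
move=> Wz; have := @pd_rsub_l R n m q (christoffel h c a b).
move=> /(congr1 (@^~ z)); apply: etrans; apply: (eq_pd_warped _ Wz) => y.
exact: christoffel_rrr.
Qed.

Lemma pd_christoffel_rrr_r d c a b z : warped_dom z ->
  pd (r d) (christoffel W (r c) (r a) (r b)) z
  = pd d (christoffel h c a b) (rsubmx z).
Proof.
move=> Wz; have := @pd_rsub_r R n m d (christoffel h c a b).
move=> /(congr1 (@^~ z)); apply: etrans; apply: (eq_pd_warped _ Wz) => y.
exact: christoffel_rrr.
Qed.

Let pd_christoffel_llr K k i b z : warped_dom z ->
  pd K (christoffel W (l k) (l i) (r b)) z = 0.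
Proof. by move=> Wz; apply: (pd_warped0 _ Wz) => y; exact: christoffel_llr. Qed.

Let pd_christoffel_lrl K k a j z : warped_dom z ->
  pd K (christoffel W (l k) (r a) (l j)) z = 0.
Proof. by move=> Wz; apply: (pd_warped0 _ Wz) => y; exact: christoffel_lrl. Qed.

Let pd_christoffel_rll K c i j z : warped_dom z ->
  pd K (christoffel W (r c) (l i) (l j)) z = 0.
Proof. by move=> Wz; apply: (pd_warped0 _ Wz) => y; exact: christoffel_rll. Qed.

(** Each of the $m$ fibre directions contributes, through
    $-\partial_j(\partial_k f / f) - \partial_j f \, \partial_k f / f^2
    + \Gamma^p_{jk} \partial_p f / f$, one copy of $- \nabla^2 f / f$. *)
Lemma ricci_warped_base j k z : warped_dom z ->
  ricci W z (l j) (l k) = ricci g (lsubmx z) j k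
    - m%:R / f (lsubmx z) * hessian g f (lsubmx z) j k.
Proof.
move=> Wz; case: (Wz) => Uz Vz; have fz := f_neq0 Uz.
rewrite [LHS]mxE big_split_ord /=; congr (_ + _).
  rewrite mxE; apply: eq_bigr => i _.
  rewrite /curvature !pd_christoffel_lll_l //; congr (_ + _).
  rewrite big_split_ord /= [X in _ + X]big1 ?addr0 => [|c _]; last first.
    by rewrite !christoffel_llr // !mul0r subrr.
  by apply: eq_bigr => p _; rewrite !christoffel_lll.
transitivity (\sum_(a < m)
    - ((f (lsubmx z))^-1 * hessian g f (lsubmx z) j k)); last first.
  by rewrite sumrN sumr_const card_ord -[X in - X]mulr_natl -[in RHS]mulrA.
apply: eq_bigr => a _; rewrite /curvature pd_christoffel_rll //.
rewrite [pd (l j) _ z](_ : _ = pd (l j) (christoffel W (r a) (l k) (r a)) z);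
  last first.
  apply: (eq_pd_warped _ Wz) => y Wy.
  by rewrite (christoffel_rlr _ _ _ Wy) (christoffel_rrl _ _ _ Wy).
rewrite pd_christoffel_rlr_l // eqxx mul1r big_split_ord /=.
under eq_bigr do rewrite christoffel_rrl // !christoffel_lll // christoffel_rll
  // mul0r subr0 eqxx mul1r.
under [X in _ + (_ + X)]eq_bigr do rewrite christoffel_rll // mulr0 sub0r
  christoffel_rlr // christoffel_rrl // -mulrA -mulrN.
rewrite sum_delta eqxx mul1r mxE mulrBr mulr_sumr.
rewrite [\sum_(p < n) _](_ : _ = \sum_(p < n) (f (lsubmx z))^-1
   * (christoffel g p j k (lsubmx z) * pd p f (lsubmx z))).
  by field.
by apply: eq_bigr => p _; ring.
Qed.

(** What survives is $\Gamma^c_{cb} \, \partial_j f / f$, with both signs. *)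
Lemma ricci_warped_base_fibre j b z : warped_dom z ->
  ricci W z (l j) (r b) = 0.
Proof.
move=> Wz; rewrite [LHS]mxE big_split_ord /=.
rewrite big1 => [|i _]; last first.
  rewrite /curvature !pd_christoffel_llr // subrr add0r big_split_ord /=.
  rewrite !big1 ?addr0 // => [d _|p _].
    by rewrite !christoffel_llr // !mul0r subrr.
  by rewrite !christoffel_llr // !mulr0 subrr.
rewrite add0r big1 // => c _; rewrite /curvature big_split_ord /=.
rewrite pd_christoffel_rlr_r // pd_christoffel_rrr_l // subrr add0r.
rewrite big1 => [|p _]; last first.
  by rewrite christoffel_llr // christoffel_rll // mulr0 mul0r subrr.
pose phi := pd j f (lsubmx z) / f (lsubmx z).
transitivity (\sum_d
    ((b == d)%:R * (christoffel h c c d (rsubmx z) * phi)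
     - (c == d)%:R * (christoffel h d c b (rsubmx z) * phi))).
  rewrite add0r; apply: eq_bigr => d _.
  rewrite !christoffel_rrr // !christoffel_rlr // (eq_sym d b) -/phi.
  by ring.
by rewrite sumrB !sum_delta subrr.
Qed.

(** The [ricci] matrix is not symmetric by definition, so the transposed block
    is computed separately; this time the two terms are $\Gamma^c_{cb}$ and
    $\Gamma^c_{bc}$, which agree because the connection is torsion-free. *)
Lemma ricci_warped_fibre_base b j z : warped_dom z ->
  ricci W z (r b) (l j) = 0.
Proof.
move=> Wz; case: (Wz) => Uz Vz; rewrite [LHS]mxE big_split_ord /=.
rewrite big1 => [|i _]; last first.
  rewrite /curvature pd_christoffel_lrl // pd_christoffel_lll_r // subrr add0r.
  rewrite big_split_ord /= !big1 ?addr0 // => [d _|p _].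
    by rewrite christoffel_llr // christoffel_rll // mulr0 mul0r subrr.
  by rewrite !christoffel_lrl // mulr0 mul0r subrr.
rewrite add0r big1 // => c _; rewrite /curvature big_split_ord /=.
rewrite !pd_christoffel_rrl_r // subrr add0r.
rewrite big1 => [|p _]; last by rewrite !christoffel_lrl // !mulr0 subrr.
pose phi := pd j f (lsubmx z) / f (lsubmx z).
transitivity (\sum_d
    ((b == d)%:R * (christoffel h c c d (rsubmx z) * phi)
     - (c == d)%:R * (christoffel h c b d (rsubmx z) * phi))).
  rewrite add0r; apply: eq_bigr => d _.
  rewrite !christoffel_rrr // !christoffel_rrl // (eq_sym d b) (eq_sym d c).
  by rewrite -/phi; ring.
by rewrite sumrB !sum_delta (christoffelC Vh _ _ _ Vz) subrr.
Qed.

(** The base directions contribute the divergence of $\nabla f$, multiplied by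
    $- f h_{ab}$.  A fibre direction $c$ contributes $- |\nabla f|^2 h_{ab}$ on
    top of the curvature of $h$, except that this is cancelled once, for
    $c = a$: hence the factor $m - 1$. *)
Lemma ricci_warped_fibre a b z : warped_dom z ->
  ricci W z (r a) (r b) = ricci h (rsubmx z) a b
    - (f (lsubmx z) * laplacian g f (lsubmx z)
       + (m%:R - 1) * \sum_p pd p f (lsubmx z) * gradient g f (lsubmx z) 0 p)
      * h (rsubmx z) a b.
Proof.
move=> Wz; case: (Wz) => Uz Vz; have fz := f_neq0 Uz.
set N := \sum_p _ * _; rewrite -(divergence_gradient Ug sf Uz).
rewrite [LHS]mxE big_split_ord /=.
pose w i := gradient g f (lsubmx z) 0 i.
rewrite [X in X + _](_ : _ = \sum_i - (f (lsubmx z) *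
    (pd i (fun x => gradient g f x 0 i) (lsubmx z)
     + \sum_p christoffel g i i p (lsubmx z) * w p) * h (rsubmx z) a b));
  last first.
  apply: eq_bigr => i _; rewrite /curvature big_split_ord /=.
  rewrite pd_christoffel_lrr_l // pd_christoffel_llr // subr0 -/(w i).
  rewrite [\sum_(p < n) _](_ : _ = - (f (lsubmx z) *
    (\sum_p christoffel g i i p (lsubmx z) * w p) * h (rsubmx z) a b));
    last first.
    rewrite -mulrA mulr_suml mulr_sumr -sumrN; apply: eq_bigr => p _.
    rewrite christoffel_lll // christoffel_lrr // christoffel_lrl // -/(w p).
    by ring.
  rewrite [\sum_(d < m) _](_ : _ = \sum_d
    (b == d)%:R * (pd i f (lsubmx z) * w i * h (rsubmx z) a d)); last first.
    apply: eq_bigr => d _; rewrite christoffel_llr // christoffel_lrr //.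
    by rewrite christoffel_rlr // -/(w i) (eq_sym d b); field.
  by rewrite sum_delta; ring.
rewrite [X in _ + X](_ : _ = \sum_c (curvature h c b c a (rsubmx z)
    - N * h (rsubmx z) a b + (a == c)%:R * (N * h (rsubmx z) c b))); last first.
  apply: eq_bigr => c _; rewrite /curvature big_split_ord /=.
  rewrite !pd_christoffel_rrr_r //.
  rewrite [\sum_(d < m) _](_ : _ = \sum_d
     (christoffel h c c d (rsubmx z) * christoffel h d a b (rsubmx z)
     - christoffel h c a d (rsubmx z) * christoffel h d c b (rsubmx z)));
    last by apply: eq_bigr => d _; rewrite !christoffel_rrr.
  rewrite [\sum_(p < n) _](_ : _ = - N * h (rsubmx z) a b
    + (a == c)%:R * (N * h (rsubmx z) c b)); last first.
    rewrite /N -sumrN 2!mulr_suml mulr_sumr -big_split /=.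
    apply: eq_bigr => p _; rewrite !christoffel_rrl // !christoffel_lrr //.
    by rewrite eqxx mul1r (eq_sym c a) -/(w p); field.
  by rewrite [X in _ + X = _]addrC mulNr !addrA.
rewrite big_split sumrB sum_delta sumr_const card_ord [ricci _ _ _ _]mxE.
rewrite sumrN -mulr_suml -mulr_sumr big_split /=.
rewrite -[X in _ - X + _]mulr_natl.
by ring.
Qed.

End warped_curvature.

(** * Warped products over a gradient soliton *)

(** A vector in the kernel of the Gram matrix would have zero length. *)
Lemma metric_local_metric (R : realType) (n : nat) (M : riemannian R n)
    (a : atlas M) : local_metric (cimg (mchart a)) (metric a).
Proof.
split; [exact: cimg_open | exact: metric_smooth | exact: Defs.metric_sym |].
move=> x ax; rewrite -row_free_unit -kermx_eq0.
apply/rowV0P => v /sub_kermxP vG.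
apply/eqP; apply: contraT => v0.
by have := metric_pos ax v0; rewrite vG mul0mx mxE ltxx.
Qed.

(** With $w = (\partial f) g^{-1}$, the square of the norm is
    $w g w^T = (\partial f) w^T$; positivity of the metric is what allows the
    square root in [tangent_norm] to be squared away. *)
Lemma tangent_norm_gradient (R : realType) (n : nat) (M : riemannian R n)
    (a : atlas M) (f : 'rV[R]_n -> R) x : cimg (mchart a) x ->
  tangent_norm (metric a) x (gradient (metric a) f x) ^+ 2
  = \sum_p pd p f x * gradient (metric a) f x 0 p.
Proof.
move=> ax; set w := gradient _ _ _; have Ma := metric_local_metric a.
have [_ _ sG uG] := Ma.
rewrite /tangent_norm sqr_sqrtr; last first.
  have [->|w0] := eqVneq w 0; first by rewrite !mul0mx mxE.
  exact/ltW/metric_pos.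
have -> : w = (\row_j pd j f x) *m invmx (metric a x).
  apply/rowP => i; rewrite !mxE; apply: eq_bigr => j _.
  by rewrite mxE mulrC (inv_metricC Ma _ _ ax).
rewrite mulmxKV ?uG // mxE; apply: eq_bigr => p _.
by rewrite mxE [_^T _ _]mxE.
Qed.

Theorem corollary1 (R : realType) (n m : nat) (hn : (3 <= n)%N) (hm : (1 < m)%N)
  (B : riemannian R n) (u : B -> R)
  (u_smooth : smooth_fun u) (u_pos : forall p : B, 0 < u p)
  (lambda : R) (soliton : gradient_soliton m%:R u lambda)
  (lambda_pos : compact [set: B] -> 0 < lambda)
  (mu : R)
  (mu_eq : forall (a : atlas B) (x : 'rV[R]_n), cimg (mchart a) x ->
     lambda * local_fun u a x ^+ 2
     + local_fun u a x * laplacian (metric a) (local_fun u a) x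
     + (m%:R - 1)
       * tangent_norm (metric a) x (gradient (metric a) (local_fun u a) x) ^+ 2
     = mu)
  (F : riemannian R m) (F_einstein : einstein F mu) :
  einstein (warped_product F u_smooth u_pos) lambda.
Proof.
move=> a z az; move: (az); rewrite cimg_prod_chart => -[Bz Fz].
set x := lsubmx z in Bz; set y := rsubmx z in Fz.
pose f := local_fun u a.1.
have f_neq0 x' : cimg (mchart a.1) x' -> f x' != 0.
  by move=> _; rewrite gt_eqF //; exact: u_pos.
have Bm := metric_local_metric a.1; have Fm := metric_local_metric a.2.
have warpedE : metric (r := warped_product F u_smooth u_pos) a =
    warped (metric a.1) (metric a.2) f.
  by apply/funext => t; exact: warped_metricE.
have Wz : warped_dom (cimg (mchart a.1)) (cimg (mchart a.2)) z by [].
have fz := f_neq0 _ Bz; rewrite warpedE; apply/matrixP => I J.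
rewrite [RHS]mxE.
have [i ->|b ->] := split_ordP I; have [j ->|c ->] := split_ordP J.
- rewrite (ricci_warped_base Bm Fm (u_smooth a.1) f_neq0 _ _ Wz).
  rewrite [warped _ _ _ _ _ _]block_mxEul.
  have /matrixP/(_ i j) := soliton.2 a.1 _ Bz.
  by rewrite [LHS]mxE [X in _ + X]mxE [X in - X]mxE [RHS]mxE.
- rewrite (ricci_warped_base_fibre Bm Fm (u_smooth a.1) f_neq0 _ _ Wz).
  by rewrite [warped _ _ _ _ _ _]block_mxEur mxE mulr0.
- rewrite (ricci_warped_fibre_base Bm Fm (u_smooth a.1) f_neq0 _ _ Wz).
  by rewrite [warped _ _ _ _ _ _]block_mxEdl mxE mulr0.
- rewrite (ricci_warped_fibre Bm Fm (u_smooth a.1) f_neq0 _ _ Wz).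
  rewrite (F_einstein _ _ Fz) [X in X - _ = _]mxE.
  rewrite [warped _ _ _ _ _ _]block_mxEdr [X in _ = _ * X]mxE.
  rewrite -(mu_eq _ _ Bz) (tangent_norm_gradient _ Bz) -/f -/x.
  by ring.
Qed.
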